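(* Let $A$ be an alternative Cartan $*$-algebra with $\mathbb{S}_A\ne\varnothing$ and let $\mathcal{C}(A)$ be its Cartan number. Then $\mathcal{C}(A)=1$ if and only if $A$ is a division algebra endowed with the standard conjugation (that is, $A$ is $*$-isomorphic to one of $\mathbb{C}$, $\mathbb{H}$, $\mathbb{O}$ endowed with the standard conjugation).
   Context: **Cartan $*$-algebras.** Let $n\ge 1$, let $\mathcal{P}(n)$ be the power set of $\{1,\dots,n\}$ and $K\triangle H:=(K\setminus H)\cup(H\setminus K)$. A Cartan algebra is a real (not necessarily associative) algebra $A$ with a fixed real vector basis $\{e_K\}_{K\in\mathcal{P}(n)}$ and a function $\sigma:\mathcal{P}(n)\times\mathcal{P}(n)\to\{-1,1\}$ such that $\sigma(K,\varnothing)=\sigma(\varnothing,K)=1$ and $e_Ke_H=\sigma(K,H)e_{K\triangle H}$ for all $K,H$. Thus $e_\varnothing=1$ is the unity, and $\mathbb{R}$ is identified with $\mathbb{R}1\subset A$. $A$ is alternative if $x(xy)=x^2y$ and $(xy)y=xy^2$ for all $x,y$. A $*$-involution is a real linear map $x\mapsto x^c$ with $(x^c)^c=x$, $(xy)^c=y^cx^c$ and $x^c=x$ for $x\in\mathbb{R}$. A $*$-isomorphism is an algebra isomorphism commuting with the $*$-involutions. A Cartan $*$-algebra is a Cartan algebra endowed with a $*$-involution such that $e_{\{k\}}^c\in\{e_{\{k\}},-e_{\{k\}}\}$ for $k=1,\dots,n$. Set $\mathbb{S}_A:=\{J\in A: J^c=-J,\ J^2=-1\}$. The paper assumes throughout that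 $A$ is alternative and $\mathbb{S}_A\neq\varnothing$. $\mathbb{C},\mathbb{H},\mathbb{O}$ are the complex numbers, quaternions and octonions. **Systems of Cartan pairs.** For $L,M\in\mathcal{P}(n)$, $(e_L,e_M)$ is a Cartan pair if $e_Le_M\in\mathbb{S}_A$ (equivalently $e_{L\triangle M}\in\mathbb{S}_A$). For a set $\mathcal{C}$ of pairs $(e_L,e_M)$, put $\mathcal{C}_1:=\{L:\exists M,\ (e_L,e_M)\in\mathcal{C}\}$ and $\mathcal{C}_2:=\{M:\exists L,\ (e_L,e_M)\in\mathcal{C}\}$. $\mathcal{C}$ is a system of Cartan pairs (SCP) of $A$ if all its elements are Cartan pairs, $\mathcal{C}_1\cup\mathcal{C}_2=\mathcal{P}(n)$ and $\mathcal{C}_1\cap\mathcal{C}_2=\varnothing$. The Cartan number is $\mathcal{C}(A):=\min\{\min\{|\mathcal{C}_1|,|\mathcal{C}_2|\}:\mathcal{C}\text{ is a SCP of }A\}$. *)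

(* Defs.v *)
From HB Require Import structures.
From mathcomp Require Import all_boot all_order all_algebra.
From mathcomp Require Import reals complex.

Set Implicit Arguments.
Unset Strict Implicit.
Unset Printing Implicit Defensive.

Import Order.TTheory GRing.Theory Num.Theory.

Local Open Scope ring_scope.

(* A finite-dimensional real algebra with unity, not necessarily associative,
   endowed with a *-involution. The real number r is identified with
   r *: sone A. *)
Record starAlgebra (R : realType) := StarAlgebra {
  star_sort :> vectType R;
  smul : star_sort -> star_sort -> star_sort;
  sone : star_sort;
  sconj : star_sort -> star_sort;
  smul_linearl : forall y, linear (fun x => smul x y);
  smul_linearr : forall x, linear (fun y => smul x y);
  smul1l : forall x, smul sone x = x;
  smul1r : forall x, smul x sone = x;
  sconj_linear : linear sconj;
  sconjK : forall x, sconj (sconj x) = x;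
  sconjM : forall x y, sconj (smul x y) = smul (sconj y) (sconj x);
  sconj_real : forall r : R, sconj (r *: sone) = r *: sone
}.

Arguments sone {R} s.

Declare Scope star_scope.
Delimit Scope star_scope with star.
Notation "x ** y" := (smul x y) (at level 40, left associativity) : star_scope.
Notation "x ^c" := (sconj x) : star_scope.
Local Open Scope star_scope.

Definition alternative (R : realType) (A : starAlgebra R) : Prop :=
  forall x y : A,
    x ** (x ** y) = (x ** x) ** y /\ (x ** y) ** y = x ** (y ** y).

Definition star_isomorphic (R : realType) (A B : starAlgebra R) : Prop :=
  exists f : {linear A -> B},
    [/\ bijective f,
        forall x y : A, f (x ** y) = f x ** f y
      & forall x : A, f x^c = (f x)^c].

(* The set S_A of imaginary units. *)
Definition imag_units (R : realType) (A : starAlgebra R) : pred A :=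
  [pred J | (J^c == - J) && (J ** J == - sone A)].

Arguments imag_units {R} A _.

Section StandardAlgebras.
Variable R : realType.

(* Rcomplex R is R[i] seen as a vector space over R. *)
Fact Rcomplex_vect_iso : Vector.axiom 2 (Rcomplex R).
Proof.
exists (fun z : Rcomplex R =>
    \row_(i < 2) (if i == 0 then complex.Re z else complex.Im z)).
  move=> a [x y] [u v]; apply/rowP=> i; rewrite !mxE /=.
  by case: (i == 0).
exists (fun v : 'rV[R]_2 => (Complex (v 0 0) (v 0 1) : Rcomplex R)).
  by case=> x y; rewrite !mxE.
move=> v; apply/rowP=> i; rewrite !mxE /=.
by case: (unliftP 0 i) => [j ->|-> //]; rewrite [j]ord1;
  congr (v 0 _); apply/val_inj.
Qed.

HB.instance Definition _ :=
  Lmodule_hasFinDim.Build R (Rcomplex R) Rcomplex_vect_iso.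

Let C := Rcomplex R.

Fact complex_mul_linearl (y : C) : linear (fun x : C => x * y).
Proof. by move=> a x z; rewrite mulrDl scalerAl. Qed.

Fact complex_mul_linearr (x : C) : linear (fun y : C => x * y).
Proof.
by move=> a y z; rewrite mulrDr [x * (a *: y)]mulrC -scalerAl [y * x]mulrC.
Qed.

Fact complex_conj_linear : linear (@conjc R : C -> C).
Proof. by move=> a [x y] [u v]; congr Complex; rewrite /= opprD mulrN. Qed.

Fact complex_conjM (x y : C) : conjc (x * y) = (conjc y : C) * conjc x :> C.
Proof. by rewrite [RHS]mulrC; case: x y => [a b] [c d]; rewrite -rmorphM. Qed.

Fact complex_conj_real (r : R) : conjc (r *: (1 : C)) = r *: (1 : C) :> C.
Proof. by congr Complex; rewrite /= mulr0 oppr0. Qed.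

Definition complex_star : starAlgebra R :=
  @StarAlgebra R C (fun x y => x * y) 1 (@conjc R)
    complex_mul_linearl complex_mul_linearr (@mul1r C) (@mulr1 C)
    complex_conj_linear (@conjcK R) complex_conjM complex_conj_real.

(* The Cayley-Dickson double A + A j of A, with j^2 = -1:
   (a, b) stands for a + b j. *)
Section CayleyDickson.
Variable A : starAlgebra R.
Let D : vectType R := (A * A)%type.

Definition cd_mul (x y : D) : D :=
  (x.1 ** y.1 - y.2^c ** x.2, y.2 ** x.1 + x.2 ** y.1^c).
Definition cd_one : D := (sone A, 0).
Definition cd_conj (x : D) : D := (x.1^c, - x.2).

Fact smulDl (x y z : A) : (x + y) ** z = x ** z + y ** z.
Proof. by have := smul_linearl z 1 x y; rewrite !scale1r. Qed.
Fact smulDr (x y z : A) : z ** (x + y) = z ** x + z ** y.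
Proof. by have := smul_linearr z 1 x y; rewrite !scale1r. Qed.
Fact smul0l (z : A) : 0 ** z = 0.
Proof. by apply: (addIr (0 ** z)); rewrite -smulDl !add0r. Qed.
Fact smul0r (z : A) : z ** 0 = 0.
Proof. by apply: (addIr (z ** 0)); rewrite -smulDr !add0r. Qed.
Fact smulZl a (x z : A) : (a *: x) ** z = a *: (x ** z).
Proof. by have := smul_linearl z a x 0; rewrite !addr0 smul0l addr0. Qed.
Fact smulZr a (x z : A) : z ** (a *: x) = a *: (z ** x).
Proof. by have := smul_linearr z a x 0; rewrite !addr0 smul0r addr0. Qed.
Fact smulNl (x z : A) : (- x) ** z = - (x ** z).
Proof. by rewrite -scaleN1r smulZl scaleN1r. Qed.
Fact smulNr (x z : A) : z ** (- x) = - (z ** x).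
Proof. by rewrite -scaleN1r smulZr scaleN1r. Qed.
Fact sconjD (x y : A) : (x + y)^c = x^c + y^c.
Proof. by have := sconj_linear 1 x y; rewrite !scale1r. Qed.
Fact sconj0 : (0 : A)^c = 0.
Proof. by have := sconj_real A 0; rewrite !scale0r. Qed.
Fact sconjZ a (x : A) : (a *: x)^c = a *: x^c.
Proof. by have := sconj_linear a x 0; rewrite sconj0 !addr0. Qed.
Fact sconjN (x : A) : (- x)^c = - x^c.
Proof. by rewrite -scaleN1r sconjZ scaleN1r. Qed.

Fact cd_mul_linearl y : linear (fun x : D => cd_mul x y).
Proof.
move=> a x z; congr pair => /=;
  rewrite !(smulDl, smulDr, smulZl, smulZr) !(scalerDr, scalerN) ?opprD.
  exact: addrACA.
exact: addrACA.
Qed.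

Fact cd_mul_linearr x : linear (fun y : D => cd_mul x y).
Proof.
move=> a y z; congr pair => /=; rewrite !(sconjD, sconjZ);
  rewrite !(smulDl, smulDr, smulZl, smulZr) !(scalerDr, scalerN) ?opprD.
  exact: addrACA.
exact: addrACA.
Qed.

Fact cd_mul1l x : cd_mul cd_one x = x.
Proof.
by case: x => a b; congr pair;
  rewrite /= !(smul1l, smul1r, smul0l, smul0r, subr0, addr0).
Qed.

Fact sconj1 : (sone A)^c = sone A.
Proof. by have := sconj_real A 1; rewrite !scale1r. Qed.

Fact cd_mul1r x : cd_mul x cd_one = x.
Proof.
by case: x => a b; congr pair;
  rewrite /= ?sconj1 ?sconj0 !(smul1l, smul1r, smul0l, smul0r, subr0, add0r).
Qed.

Fact cd_conj_linear : linear cd_conj.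
Proof.
move=> a x y; congr pair; first by rewrite /= sconjD sconjZ.
by rewrite /= opprD scalerN.
Qed.

Fact cd_conjK x : cd_conj (cd_conj x) = x.
Proof. by case: x => a b; rewrite /cd_conj /= sconjK opprK. Qed.

Fact cd_conjM x y : cd_conj (cd_mul x y) = cd_mul (cd_conj y) (cd_conj x).
Proof.
congr pair;
  rewrite /= !(sconjD, sconjN, sconjM, sconjK, smulNl, smulNr) ?opprK //.
by rewrite opprD addrC.
Qed.

Fact cd_conj_real (r : R) : cd_conj (r *: cd_one) = r *: cd_one.
Proof. by congr pair; rewrite /= ?sconj_real // scaler0 oppr0. Qed.

Definition cayley_dickson : starAlgebra R :=
  @StarAlgebra R D cd_mul cd_one cd_conj cd_mul_linearl cd_mul_linearr
    cd_mul1l cd_mul1r cd_conj_linear cd_conjK cd_conjM cd_conj_real.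

End CayleyDickson.

Definition quaternion_star : starAlgebra R := cayley_dickson complex_star.
Definition octonion_star : starAlgebra R := cayley_dickson quaternion_star.

End StandardAlgebras.

Definition standard_division_algebra (R : realType) (A : starAlgebra R) :=
  [\/ star_isomorphic A (complex_star R),
      star_isomorphic A (quaternion_star R)
    | star_isomorphic A (octonion_star R)].

Definition symdiff (T : finType) (K H : {set T}) : {set T} :=
  (K :\: H) :|: (H :\: K).

(* The indices 1, ..., n are represented by 'I_n. *)
Record cartanStarAlgebra (R : realType) (n : nat) := CartanStarAlgebra {
  cartan_star :> starAlgebra R;
  cbase : {set 'I_n} -> cartan_star;
  csign : {set 'I_n} -> {set 'I_n} -> R;
  cbase_basis : basis_of fullv (codom cbase);
  csign_pm1 : forall K H, csign K H = -1 \/ csign K H = 1;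
  csign0r : forall K, csign K set0 = 1;
  csign0l : forall K, csign set0 K = 1;
  cbaseM : forall K H,
    cbase K ** cbase H = csign K H *: cbase (symdiff K H);
  cbase_conj : forall k : 'I_n,
    (cbase [set k])^c = cbase [set k] \/ (cbase [set k])^c = - cbase [set k]
}.

Lemma cbase0 (R : realType) (n : nat) (A : cartanStarAlgebra R n) :
  cbase A set0 = sone A.
Proof.
rewrite -[LHS]smul1r.
have /andP[/eqP sp _] := cbase_basis A.
have /coord_span -> : sone A \in <<in_tuple (codom (cbase A))>>%VS.
  by rewrite sp memvf.
rewrite (big_morph _ (fun x y => smulDr x y (cbase A set0)) (smul0r _)).
apply: eq_bigr => i _; rewrite smulZr; congr (_ *: _).
have /codomP[K ->] : (codom (cbase A))`_i \in codom (cbase A).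
  by rewrite mem_nth.
by rewrite cbaseM csign0l scale1r /symdiff set0D setD0 set0U.
Qed.

Section CartanNumber.
Variables (R : realType) (n : nat) (A : cartanStarAlgebra R n).

Definition cartan_pair (L M : {set 'I_n}) : bool :=
  cbase A L ** cbase A M \in imag_units A.

(* A set of pairs (e_L, e_M) is represented by the set of the pairs (L, M). *)
Implicit Type C : {set {set 'I_n} * {set 'I_n}}.

Definition scp_left C : {set {set 'I_n}} := [set p.1 | p in C].
Definition scp_right C : {set {set 'I_n}} := [set p.2 | p in C].

Definition scp C : bool :=
  [&& [forall p in C, cartan_pair p.1 p.2],
      scp_left C :|: scp_right C == [set: {set 'I_n}]
    & scp_left C :&: scp_right C == set0].

Definition scp_size C : nat := minn #|scp_left C| #|scp_right C|.

(* The neutral value 2 ^ n is the cardinality of the power set, hence at least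
   the size of any SCP; it is reached only when A has no SCP
   (see cartan_number_min). *)
Definition cartan_number : nat := \big[minn/(2 ^ n)%N]_(C | scp C) scp_size C.

Lemma cartan_number_min :
  (exists C, scp C) ->
  (exists2 C, scp C & cartan_number = scp_size C)
  /\ (forall C, scp C -> (cartan_number <= scp_size C)%N).
Proof.
have le2n C : (scp_size C <= 2 ^ n)%N.
  have <- : #|[set: {set 'I_n}]| = (2 ^ n)%N.
    by rewrite -powersetT card_powerset cardsT card_ord.
  by apply: leq_trans (geq_minl _ _) _; rewrite subset_leq_card // subsetT.
move=> [C0 C0P]; have ub C : scp C -> (cartan_number <= scp_size C)%N.
  by move=> CP; rewrite /cartan_number -minEnat -leEnat; apply: bigmin_le_cond.
split=> //; pose P m := exists2 C, scp C & m = scp_size C.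
have [m2n|] : cartan_number = (2 ^ n)%N \/ P cartan_number.
- rewrite /cartan_number; elim/big_ind: _ => [|x y Hx Hy|C CP]; first by left.
    by rewrite /minn; case: ifP.
  by right; exists C.
- exists C0 => //; apply/eqP; rewrite eqn_leq ub //=.
  by rewrite m2n le2n.
by [].
Qed.

End CartanNumber.

(* Main.v *)
Require Import Defs.
From HB Require Import structures.
From mathcomp Require Import all_boot all_order all_algebra.
From mathcomp Require Import reals complex.

(** For a nonempty set [K] of indices write e_K for the basis vector.  Both
    implications go through one condition, [unit_basis]: every e_K with K
    nonempty is an imaginary unit.

    A system of Cartan pairs with a side reduced to one set L must pair L with
    every other set, so that e_H is an imaginary unit for every nonempty H
    (take the partner of L to be the symmetric difference of L and H);
    conversely, if all these e_H are imaginary units, then the pairs with left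
    member the empty set form a system of size one.  This is the content of
    [cartan_number1_unit_basis] and [unit_basis_cartan_number1].

    It remains to compare [unit_basis] with the three standard algebras.
    Under [unit_basis], distinct e_K with K nonempty anticommute, and x + x^c
    is always a real number.  With that, alternativity alone
    proves Hurwitz's doubling step ([doubling_star_hom]): a star
    homomorphism from B to A whose image is orthogonal to a unit j extends to
    the Cayley-Dickson double of B, by sending (a, b) to a + b j.  Doubling
    along e_{1}, e_{2}, e_{3} in turn produces homomorphisms from the complex
    numbers, the quaternions and the octonions to A; they are injective, since
    x x^c is a positive real for x nonzero in these algebras, and so
    bijective when the dimension is 2, 4 or 8.  Larger dimensions do not occur:
    three independent basis units satisfy a (b c) = - (a b) c
    ([cbase_antiassoc]), and with a fourth unit the two ways of reassociating
    a (b (c d)) have opposite signs ([unit_basis_le3]).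

    In the other direction, x + x^c is real and x x^c is a nonnegative real
    in a standard algebra, hence in A ([definite_unit_basis]).  Since e_K
    squares to 1 or -1 and is not real, comparing coefficients in
    e_K e_K^c = e_K (t - e_K) forces t = 0 and e_K^2 = -1. *)

Set Implicit Arguments.
Unset Strict Implicit.
Unset Printing Implicit Defensive.

Import Order.TTheory GRing.Theory Num.Theory.

Local Open Scope ring_scope.
Local Open Scope star_scope.

(** * Traces, norms and star homomorphisms *)

Definition scalar_trace (R : realType) (A : starAlgebra R) : Prop :=
  forall x : A, exists t : R, x + x^c = t *: sone A.

Definition definite_norm (R : realType) (A : starAlgebra R) : Prop :=
  forall x : A,
    exists m : R, [/\ 0 <= m, x ** x^c = m *: sone A & m = 0 -> x = 0].

Definition star_hom (R : realType) (B A : starAlgebra R) (g : B -> A) : Prop :=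
  [/\ linear g, g (sone B) = sone A,
      forall x y, g (x ** y) = g x ** g y & forall x, g x^c = (g x)^c].

Section StarHom.
Variables (R : realType) (A B : starAlgebra R) (g : A -> B).
Hypothesis gh : star_hom g.

Lemma star_homD x y : g (x + y) = g x + g y.
Proof. by case: gh => gl _ _ _; have := gl 1 x y; rewrite !scale1r. Qed.

Lemma star_hom0 : g 0 = 0.
Proof. by apply: (addIr (g 0)); rewrite -star_homD !add0r. Qed.

Lemma star_homZ a x : g (a *: x) = a *: g x.
Proof.
by case: gh => gl _ _ _; have := gl a x 0; rewrite star_hom0 !addr0.
Qed.

Lemma star_homN x : g (- x) = - g x.
Proof. by rewrite -scaleN1r star_homZ scaleN1r. Qed.

End StarHom.

(** * Doubling a subalgebra of an alternative algebra *)

(** For a unit [j] with [j^c = - j] this says that [x] and [j] are orthogonal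
    for the form [x ** y^c + y ** x^c]; it is the commutation rule between
    a summand and the new unit in a Cayley-Dickson double. *)
Definition twists (R : realType) (A : starAlgebra R) (j x : A) : Prop :=
  x ** j = j ** x^c.

Section AlternativeDoubling.
Variables (R : realType) (A : starAlgebra R).
Hypothesis altA : alternative A.
Implicit Types x y z j : A.

(** The left alternative law applied to [x + y]. *)
Lemma alt_linearl x y z :
  x ** (y ** z) + y ** (x ** z) = (x ** y + y ** x) ** z.
Proof.
have [H _] := altA (x + y) z; have [Hx _] := altA x z; have [Hy _] := altA y z.
move: H; rewrite !(smulDl, smulDr) Hx Hy.
rewrite -!addrA => /addrI; rewrite !addrA => /addIr.
by [].
Qed.

(** The right alternative law applied to [x + y]. *)
Lemma alt_linearr x y z :
  (z ** x) ** y + (z ** y) ** x = z ** (x ** y + y ** x).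
Proof.
have [_ H] := altA z (x + y); have [_ Hx] := altA z x; have [_ Hy] := altA z y.
move: H; rewrite !(smulDl, smulDr) Hx Hy.
rewrite -!addrA => /addrI; rewrite !addrA => /addIr.
by rewrite addrC => ->; rewrite addrC.
Qed.

Hypothesis trA : scalar_trace A.
Variable j : A.
Hypotheses (jc : j^c = - j) (jj : j ** j = - sone A).

(** Since [x^c = t - x], twisting amounts to anticommuting up to the trace [t],
    the form in which linearized alternativity can use it. *)
Lemma twist_sum x : twists j x ->
  exists2 t : R, x^c = t *: sone A - x & x ** j + j ** x = t *: j.
Proof.
move=> xj; have [t tx] := trA x; exists t; first by rewrite -tx addrC addKr.
by rewrite xj -smulDr addrC tx smulZr smul1r.
Qed.

(** By linearized left alternativity, [a (j z) + j (a z) = (a j + j a) z], which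
    is [j (t z)] where [t] is the trace of [a]; and [a^c = t - a]. *)
Lemma twist_mull a z : twists j a -> a ** (j ** z) = j ** (a^c ** z).
Proof.
move=> /twist_sum[t -> e]; have := alt_linearl a j z.
move/(canRL (addrK _)) ->.
by rewrite e !(smulDl, smulDr, smulNl, smulNr, smulZl, smulZr) smul1l.
Qed.

(** The mirror image of [twist_mull]. *)
Lemma twist_mulr z x : twists j x -> (z ** j) ** x = (z ** x^c) ** j.
Proof.
move=> /twist_sum[t -> e]; have := alt_linearr j x z.
move/(canRL (addrK _)) ->; rewrite [j ** x + _]addrC.
by rewrite e !(smulDl, smulDr, smulNl, smulNr, smulZl, smulZr) smul1r.
Qed.

(** The product of a summand [a] and a summand [d j] in a Cayley-Dickson
    double, which comes from [twist_mull] by writing [d j] as [j d^c]. *)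
Lemma twist_assoc a d : twists j a -> twists j d -> twists j (d ** a) ->
  a ** (d ** j) = (d ** a) ** j.
Proof. by move=> ja jd jda; rewrite jd twist_mull // -sconjM jda. Qed.

(** The product of [b j] and [d j] in a Cayley-Dickson double.  This is usually
    derived from the middle Moufang identity; here linearized right
    alternativity in the triple [b], [j], [d j] is enough, because
    [(b (d j)) j] and [j (d j) + (d j) j] are already known. *)
Lemma twist_mulj b d : twists j b -> twists j d -> twists j (d ** b) ->
  (b ** j) ** (d ** j) = - (d^c ** b).
Proof.
move=> jb jd jdb; have := alt_linearr j (d ** j) b.
move/(canRL (addrK _)) ->.
rewrite (twist_assoc jb jd jdb).
have [_ ->] := altA (d ** b) j; have [_ ->] := altA d j.
have [t dt] := trA d.
rewrite {1}jd; have [-> _] := altA j d^c.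
rewrite jj !(smulNl, smulNr) smul1l !smul1r -opprD addrC [d^c + d]addrC dt.
rewrite smulNr smulZr smul1r opprK.
have -> : d^c = t *: sone A - d by rewrite -dt addrC addKr.
by rewrite smulDl smulNl smulZl smul1l opprB.
Qed.

(** Hurwitz's doubling step: each of the four products of summands follows the
    Cayley-Dickson rule, by the lemmas above. *)
Lemma doubling_star_hom (B : starAlgebra R) (g : B -> A) :
  star_hom g -> (forall b, twists j (g b)) ->
  star_hom (fun x : cayley_dickson B => g x.1 + g x.2 ** j).
Proof.
move=> gh gj; have [_ g1 gM gc] := gh.
have gD := star_homD gh; have gZ := star_homZ gh; have gN := star_homN gh.
split=> [a [x1 x2] [y1 y2]||[a b] [c d]|[a b]] /=.
- by rewrite !gD !gZ smulDl smulZl scalerDr addrACA.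
- by rewrite (star_hom0 gh) smul0l addr0.
- rewrite smulDl !smulDr !gD !gN !gM !gc.
  rewrite (twist_assoc (gj a) (gj d)) -?gM // (twist_mulr _ (gj c)).
  rewrite twist_mulj -?gM // smulDl.
  by rewrite addrACA [- _ + _]addrC.
- by rewrite sconjD sconjM gc gN jc !smulNl gj.
Qed.

End AlternativeDoubling.


(** * The standard algebras have scalar traces and definite norms *)

Section DefiniteNorm.
Variable R : realType.
Implicit Types A B : starAlgebra R.

Lemma complex_scalar_trace : scalar_trace (complex_star R).
Proof.
move=> [a b]; exists (a + a).
by congr Complex; rewrite /= ?mulr1 ?mulr0 ?subrr.
Qed.

Lemma complex_definite_norm : definite_norm (complex_star R).
Proof.
move=> [a b]; exists (a ^+ 2 + b ^+ 2); split.
- by rewrite addr_ge0 ?sqr_ge0.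
- congr Complex; rewrite /= ?mulr1 ?mulr0 mulrN ?opprK ?expr2 //.
  by rewrite mulrC addNr.
- move/eqP; rewrite paddr_eq0 ?sqr_ge0 // !sqrf_eq0.
  by case/andP=> /eqP-> /eqP->.
Qed.

Lemma cd_scalar_trace A : scalar_trace A -> scalar_trace (cayley_dickson A).
Proof.
move=> trA [a b]; have [t at_] := trA a; exists t.
by congr pair; rewrite /= ?at_ // subrr scaler0.
Qed.

Lemma cd_definite_norm A : definite_norm A -> definite_norm (cayley_dickson A).
Proof.
move=> dA [a b]; have [p [p0 ap pz]] := dA a.
(* The norm of b^c, since it is b^c b which occurs in the double. *)
have [q [q0 bq qz]] := dA b^c.
exists (p + q); split; first by rewrite addr_ge0.
- congr pair; rewrite /= ?sconjK.
    by rewrite ap sconjN smulNl opprK -{2}[b]sconjK bq scalerDl.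
  by rewrite smulNl addNr scaler0.
- move/eqP; rewrite paddr_eq0 // => /andP[/eqP/pz-> /eqP/qz b0].
  by rewrite -[b]sconjK b0 sconj0.
Qed.

(** A property stable under doubling and under isomorphism holds in the three
    standard algebras once it holds in the complex numbers. *)
Lemma standard_transfer (P : starAlgebra R -> Prop) A :
  (forall B, star_isomorphic A B -> P B -> P A) ->
  P (complex_star R) -> (forall B, P B -> P (cayley_dickson B)) ->
  standard_division_algebra A -> P A.
Proof.
move=> tr PC Pcd [] iso; apply: (tr _ iso).
- exact: PC.
- exact: Pcd PC.
- exact: Pcd (Pcd _ PC).
Qed.

Lemma star_iso_inv A B : star_isomorphic A B ->
  exists2 g : A -> B, injective g & star_hom g.
Proof.
move=> [f [[h fK hK] fM fc]]; exists f; first exact: can_inj fK.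
split=> //; first by move=> a x y; rewrite linearP.
have e y : f (sone A) ** y = y by rewrite -[y]hK -fM smul1l.
by rewrite -[LHS]smul1r e.
Qed.

Lemma scalar_trace_iso A B :
  star_isomorphic A B -> scalar_trace B -> scalar_trace A.
Proof.
move=> /star_iso_inv[g g_inj gh] trB x; have [t gt] := trB (g x); exists t.
apply: g_inj; rewrite star_homD // star_homZ //.
by case: gh => _ -> _ ->.
Qed.

Lemma definite_norm_iso A B :
  star_isomorphic A B -> definite_norm B -> definite_norm A.
Proof.
move=> /star_iso_inv[g g_inj gh] dB x; have [m [m0 gm mz]] := dB (g x).
exists m; split=> //.
  apply: g_inj; rewrite star_homZ //.
  by case: gh => _ -> -> ->.
move=> /mz gx0; apply: g_inj; rewrite gx0.
by rewrite star_hom0.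
Qed.

(** If [g x = 0], then [x x^c], a real number, is sent to itself and to 0. *)
Lemma definite_star_hom_inj A B (g : B -> A) :
  definite_norm B -> sone A != 0 -> star_hom g -> injective g.
Proof.
move=> dB A1 gh x y gxy.
have g0 : g (x - y) = 0.
  by rewrite star_homD // star_homN // gxy subrr.
have [m [_ e mz]] := dB (x - y); apply/eqP; rewrite -subr_eq0; apply/eqP/mz.
have := congr1 g e; rewrite star_homZ //; case: gh => _ -> -> _.
by rewrite g0 smul0l => /esym/eqP; rewrite scaler_eq0 (negPf A1) orbF => /eqP.
Qed.

Lemma star_hom_iso A B (g : B -> A) :
  star_hom g -> injective g -> \dim {: B} = \dim {: A} -> star_isomorphic A B.
Proof.
move=> [gl g1 gM gc] g_inj dimBA.
pose G : {linear B -> A} := HB.pack g (GRing.isLinear.Build _ _ _ _ g gl).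
pose h := linfun G; have hE x : h x = g x by rewrite lfunE.
have kh : lker h == 0%VS by apply/lker0P=> x y; rewrite !hE => /g_inj.
have imh : limg h = fullv.
  apply/eqP; rewrite eqEdim subvf limg_dim_eq ?(eqP kh) ?capv0 //.
  by rewrite dimBA leqnn.
have hK := lker0_lfunK kh.
have hVK x : h (h^-1%VF x) = x by rewrite limg_lfunVK // imh memvf.
exists h^-1%VF; split; first by exists h.
  by move=> x y; rewrite -[RHS]hK hE gM -!hE !hVK.
by move=> x; rewrite -[RHS]hK hE gc -!hE hVK.
Qed.

End DefiniteNorm.

(** * Symmetric differences of sets of indices *)

Section SymmetricDifference.
Variable T : finType.
Implicit Types H K L : {set T}.

Lemma in_symdiff x H K : (x \in symdiff H K) = (x \in H) (+) (x \in K).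
Proof. by rewrite !inE; case: (x \in H); case: (x \in K). Qed.

Lemma symdiffC H K : symdiff H K = symdiff K H.
Proof. by apply/setP=> x; rewrite !in_symdiff addbC. Qed.

Lemma symdiffKl H K : symdiff H (symdiff H K) = K.
Proof. by apply/setP=> x; rewrite !in_symdiff addKb. Qed.

Lemma symdiff0r H : symdiff H set0 = H.
Proof. by apply/setP=> x; rewrite in_symdiff inE addbF. Qed.

Lemma symdiff0l H : symdiff set0 H = H.
Proof. by rewrite symdiffC symdiff0r. Qed.

Lemma symdiffxx H : symdiff H H = set0.
Proof. by rewrite -{2}[H]symdiff0r symdiffKl. Qed.

Lemma symdiff_eq0 H K : (symdiff H K == set0) = (H == K).
Proof.
apply/eqP/eqP=> [e|->]; last exact: symdiffxx.
by rewrite -[K](symdiffKl H) e symdiff0r.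
Qed.

End SymmetricDifference.

(** * The basis of a Cartan algebra *)

Section CartanBasis.
Variables (R : realType) (n : nat) (A : cartanStarAlgebra R n).
Implicit Types (x y z : A) (H K L : {set 'I_n}).
Local Notation e := (cbase A).

Lemma dim_cartan : \dim {: A} = (2 ^ n)%N.
Proof.
have /andP[/eqP <- /eqP ->] := cbase_basis A.
by rewrite size_image -cardsT -powersetT card_powerset cardsT card_ord.
Qed.

Lemma cbase_neq0 K : e K != 0.
Proof.
have /andP[_ fr] := cbase_basis A.
by apply: free_not0 fr _; exact: codom_f.
Qed.

Lemma sone_neq0 : sone A != 0.
Proof. by rewrite -cbase0 cbase_neq0. Qed.

Lemma cbase_not_scalar K a : K != set0 -> e K != a *: sone A.
Proof.
move=> K0; have /andP[_ fr] := cbase_basis A; rewrite -cbase0.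
have e_inj : injective e by apply/injectiveP; exact: free_uniq fr.
have: free [:: e K; e set0].
  rewrite -(@perm_free _ _ (filter (pred2 (e K) (e set0)) (codom e))).
    exact: filter_free.
  apply: uniq_perm => [||x].
  - by rewrite filter_uniq // free_uniq.
  - by rewrite /= inE (inj_eq e_inj) K0.
  - rewrite mem_filter !inE andb_idr //.
    by case/orP=> /eqP ->; exact: codom_f.
rewrite free_cons span_seq1 => /andP[+ _]; apply: contraNneq => ->.
by apply/vlineP; exists a.
Qed.

Lemma cbase_ind (P : A -> Prop) :
  P 0 -> (forall a K x, P x -> P (a *: e K + x)) -> forall x, P x.
Proof.
move=> P0 PS x; have /andP[/eqP sp _] := cbase_basis A.
have /coord_span -> : x \in <<in_tuple (codom e)>>%VS by rewrite sp memvf.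
elim/big_rec: _ => // i y _ Py.
have /codomP[K ->] : (codom e)`_i \in codom e by rewrite mem_nth.
exact: PS.
Qed.

Lemma csignM H K : csign A H K * csign A H K = 1.
Proof. by case: (csign_pm1 A H K) => ->; rewrite ?mulrNN mulr1. Qed.

Lemma imag_unitsP x :
  reflect (x^c = - x /\ x ** x = - sone A) (x \in imag_units A).
Proof. by apply: (iffP andP) => -[/eqP ? /eqP ?]. Qed.

(** Imaginary units are stable under a change of sign, so only the symmetric
    difference matters. *)
Lemma cartan_pairE H K : cartan_pair A H K = (e (symdiff H K) \in imag_units A).
Proof.
rewrite /cartan_pair cbaseM; set s := csign A H K; set u := e _.
have ss : s * s = 1 by exact: csignM.
apply/imag_unitsP/imag_unitsP => -[uc uu].
  split; last by rewrite -uu smulZl smulZr scalerA ss scale1r.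
  by rewrite -[u]scale1r -ss -scalerA -scalerN -uc sconjZ.
by rewrite sconjZ uc scalerN smulZl smulZr scalerA ss scale1r.
Qed.

(** * Algebras whose basis consists of imaginary units *)

Definition unit_basis := forall K, K != set0 -> e K \in imag_units A.

Section UnitBasis.
Hypothesis eU : unit_basis.

Lemma cbase_conjN K : K != set0 -> (e K)^c = - e K.
Proof. by case/eU/imag_unitsP. Qed.

Lemma cbase_sqr K : K != set0 -> e K ** e K = - sone A.
Proof. by case/eU/imag_unitsP. Qed.

(** Up to sign, the product is again a basis unit, which the involution negates;
    but the involution also exchanges the two factors. *)
Lemma cbase_anticomm H K : H != set0 -> K != set0 -> H != K ->
  e H ** e K = - (e K ** e H).
Proof.
move=> H0 K0 HK; have D0 : symdiff H K != set0 by rewrite symdiff_eq0.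
have := sconjM (e H) (e K); rewrite !cbase_conjN // smulNl smulNr opprK => <-.
by rewrite cbaseM sconjZ cbase_conjN // scalerN opprK.
Qed.

Lemma unit_basis_scalar_trace : scalar_trace A.
Proof.
apply: cbase_ind => [|a K x [t xt]].
  by exists 0; rewrite sconj0 addr0 scale0r.
rewrite sconjD sconjZ; have [->|K0] := eqVneq K set0.
  exists (a + a + t); rewrite cbase0 sconj1 addrACA xt.
  by rewrite !scalerDl.
by exists t; rewrite cbase_conjN // scalerN addrACA subrr add0r.
Qed.

Lemma twists_cbase K L : K != set0 -> L != K -> twists (e K) (e L).
Proof.
move=> K0 LK; rewrite /twists; have [-> |L0] := eqVneq L set0.
  by rewrite cbase0 sconj1 smul1l smul1r.
by rewrite cbase_conjN // cbase_anticomm // smulNr.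
Qed.

(** Linearized left alternativity makes [a (b z) = - b (a z)] for anticommuting
    [a] and [b].  Hence, with [c] anticommuting with [a], [b] and [a b],
    [a (b c) = - b (a c) = b (c a) = - c (b a) = c (a b) = - (a b) c]. *)
Lemma cbase_antiassoc H K L : H != set0 -> K != set0 -> L != set0 ->
  H != K -> K != L -> H != L -> symdiff H K != L -> alternative A ->
  e H ** (e K ** e L) = - ((e H ** e K) ** e L).
Proof.
move=> H0 K0 L0 HK KL HL HKL altA.
have flip x y z : x ** y = - (y ** x) -> x ** (y ** z) = - (y ** (x ** z)).
  move=> xy; apply/eqP; rewrite -addr_eq0 alt_linearl // xy addNr.
  by rewrite smul0l.
have D0 : symdiff H K != set0 by rewrite symdiff_eq0.
rewrite (flip _ _ _ (cbase_anticomm H0 K0 HK)) (cbase_anticomm H0 L0 HL).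
rewrite smulNr opprK (flip _ _ _ (cbase_anticomm K0 L0 KL)).
rewrite -smulNr -(cbase_anticomm H0 K0 HK) cbaseM smulZr smulZl -scalerN.
by rewrite (cbase_anticomm D0 L0 HKL) opprK.
Qed.

(** The form of [cbase_antiassoc] suited to products of basis vectors, which are
    basis vectors up to a factor.  The points [p], [q], [r] witness that each of
    the three sets contributes a new index, which implies all the inequalities
    between sets required there. *)
Lemma multiple_antiassoc p q r H K L x y z : alternative A ->
  p \in H -> q \in K :\: H -> r \in L :\: (H :|: K) ->
  (exists a, x = a *: e H) -> (exists b, y = b *: e K) ->
  (exists c, z = c *: e L) -> x ** (y ** z) = - ((x ** y) ** z).
Proof.
move=> altA pH; rewrite inE => /andP[/negPf qH qK].
rewrite !inE negb_or => /andP[/andP[/negPf rH /negPf rK] rL].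
move=> [a ->] [b ->] [c ->]; rewrite !(smulZl, smulZr) cbase_antiassoc //.
- by rewrite !scalerN !scalerA -[c * a * b]mulrA [c * _]mulrC.
- by apply/set0Pn; exists p.
- by apply/set0Pn; exists q.
- by apply/set0Pn; exists r.
- by apply/eqP=> /setP/(_ q); rewrite qH qK.
- by apply/eqP=> /setP/(_ r); rewrite rK rL.
- by apply/eqP=> /setP/(_ r); rewrite rH rL.
- by apply/eqP=> /setP/(_ r); rewrite in_symdiff rH rK rL.
Qed.

(** For four basis units with singleton indices, moving the parentheses of
    [a (b (c d))] directly gives [- (a b) (c d)], and moving them through
    [a ((b c) d)] gives [(a b) (c d)]; but this product is not zero. *)
Lemma unit_basis_le3 : alternative A -> (n <= 3)%N.
Proof.
move=> altA; rewrite leqNgt; apply/negP=> n4.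
pose p k (k4 : (k < 4)%N) : 'I_n := Ordinal (leq_trans k4 n4).
pose p0 := @p 0%N isT; pose p1 := @p 1%N isT.
pose p2 := @p 2%N isT; pose p3 := @p 3%N isT.
pose a := e [set p0]; pose b := e [set p1]; pose c := e [set p2].
pose d := e [set p3].
have mult1 K : exists t, e K = t *: e K by exists 1; rewrite scale1r.
have mult2 H K : exists t, e H ** e K = t *: e (symdiff H K).
  by exists (csign A H K); rewrite cbaseM.
have a_b_cd : a ** (b ** (c ** d)) = - ((a ** b) ** (c ** d)).
  apply: (@multiple_antiassoc p0 p1 p2 _ _ _ _ _ _ altA); last exact: mult2;
    try exact: mult1; by rewrite !inE.
have b_c_d : b ** (c ** d) = - ((b ** c) ** d).
  apply: (@multiple_antiassoc p1 p2 p3 _ _ _ _ _ _ altA); last exact: mult1;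
    try exact: mult1; by rewrite !inE.
have a_bc_d : a ** ((b ** c) ** d) = - ((a ** (b ** c)) ** d).
  apply: (@multiple_antiassoc p0 p1 p3 _ _ _ _ _ _ altA); last exact: mult1;
    try exact: mult1; try exact: mult2; by rewrite !inE.
have a_b_c : a ** (b ** c) = - ((a ** b) ** c).
  apply: (@multiple_antiassoc p0 p1 p2 _ _ _ _ _ _ altA); last exact: mult1;
    try exact: mult1; by rewrite !inE.
have ab_c_d : (a ** b) ** (c ** d) = - (((a ** b) ** c) ** d).
  apply: (@multiple_antiassoc p0 p2 p3 _ _ _ _ _ _ altA); last exact: mult1;
    try exact: mult1; try exact: mult2; by rewrite !inE.
move: a_b_cd; rewrite b_c_d smulNr a_bc_d opprK a_b_c smulNl -ab_c_d.
move/eqP; rewrite -addr_eq0 -mulr2n -scaler_nat scaler_eq0 pnatr_eq0 /=.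
rewrite !cbaseM smulZl smulZr cbaseM !scaler_eq0 (negPf (cbase_neq0 _)) orbF.
have csign_neq0 H K : (csign A H K == 0) = false.
  by apply/eqP=> s0; have /eqP := csignM H K; rewrite s0 mul0r eq_sym oner_eq0.
by rewrite !csign_neq0.
Qed.

Section ImaginaryGenerator.
Hypothesis altA : alternative A.
Variable i : 'I_n.
Local Notation j := (e [set i]).

Lemma set1_neq0 : [set i] != set0 :> {set 'I_n}.
Proof. by apply/set0Pn; exists i; rewrite inE. Qed.

Lemma complex_star_hom :
  star_hom
    (fun z : complex_star R => complex.Re z *: sone A + complex.Im z *: j).
Proof.
have i0 := set1_neq0; split=> [a [x y] [u v]||[x y] [u v]|[x y]] /=.
- by rewrite !scalerDl -!scalerA scalerDr addrACA.
- by rewrite scale1r scale0r addr0.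
- rewrite !smulDl !smulDr !smulZl !smulZr !smul1l !smul1r cbase_sqr //.
  by rewrite !scalerA !scalerN scalerBl scalerDl addrACA [- _ + _]addrC.
- by rewrite sconjD !sconjZ sconj1 cbase_conjN // scalerN scaleNr.
Qed.

Lemma cbase_doubling (B : starAlgebra R) (g : B -> A) :
  star_hom g -> (forall b, twists j (g b)) ->
  star_hom (fun x : cayley_dickson B => g x.1 + g x.2 ** j).
Proof.
have i0 := set1_neq0; apply: doubling_star_hom => //.
- exact: unit_basis_scalar_trace.
- exact: cbase_conjN.
- exact: cbase_sqr.
Qed.

End ImaginaryGenerator.

Lemma twistsD z x y : twists z x -> twists z y -> twists z (x + y).
Proof. by rewrite /twists sconjD smulDl smulDr => -> ->. Qed.

Lemma twistsZ z a x : twists z x -> twists z (a *: x).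
Proof. by rewrite /twists sconjZ smulZl smulZr => ->. Qed.

Lemma twists1 z : twists z (sone A).
Proof. by rewrite /twists sconj1 smul1l smul1r. Qed.

Lemma star_hom_dim_iso (B : starAlgebra R) (g : B -> A) :
  definite_norm B -> \dim {: B} = (2 ^ n)%N -> star_hom g ->
  star_isomorphic A B.
Proof.
move=> dB dimB gh; apply: (star_hom_iso gh).
  exact: definite_star_hom_inj dB sone_neq0 gh.
by rewrite dimB dim_cartan.
Qed.

End UnitBasis.

End CartanBasis.

(** * From imaginary units to the standard algebras *)

(** The units used for the successive doublings are those of the first, second
    and third index; orthogonality of the image to the next unit holds since
    that image is spanned by the vectors e_K for the K made of earlier
    indices. *)
Lemma unit_basis_standard (R : realType) (n : nat) (A : cartanStarAlgebra R n) :
  (0 < n)%N -> alternative A -> unit_basis A -> standard_division_algebra A.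
Proof.
move=> n0 altA eU; have n3 := unit_basis_le3 eU altA.
have twC (i k : 'I_n) : k != i -> forall z : complex_star R,
    twists (cbase A [set k])
      (complex.Re z *: sone A + complex.Im z *: cbase A [set i]).
  move=> ki z; apply: twistsD; apply: twistsZ; first exact: twists1.
  apply: (twists_cbase eU (set1_neq0 _)).
  by rewrite (inj_eq set1_inj) eq_sym.
have twM (i k l : 'I_n) : l != i -> l != k ->
    twists (cbase A [set l]) (cbase A [set i] ** cbase A [set k]).
  move=> li lk; rewrite cbaseM; apply: twistsZ.
  apply: (twists_cbase eU (set1_neq0 _)); apply/eqP=> /setP/(_ l).
  by rewrite in_symdiff !inE (negPf li) (negPf lk) eqxx.
have tw1 (i k : 'I_n) : k != i -> twists (cbase A [set k]) (cbase A [set i]).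
  move=> ki; apply: (twists_cbase eU (set1_neq0 _)).
  by rewrite (inj_eq set1_inj) eq_sym.
have dC := @complex_definite_norm R.
pose i0 : 'I_n := Ordinal n0; have hC := complex_star_hom eU i0.
have [n1|n1] := leqP n 1.
  apply: Or31; apply: star_hom_dim_iso hC => //.
  by rewrite dimvf (_ : n = 1%N) //; apply/eqP; rewrite eqn_leq n1.
pose i1 : 'I_n := Ordinal n1.
have hH := cbase_doubling eU altA hC (twC i0 i1 isT).
have [n2|n2] := leqP n 2.
  apply: Or32; apply: star_hom_dim_iso hH; first exact: cd_definite_norm.
  by rewrite dimvf (_ : n = 2%N) //; apply/eqP; rewrite eqn_leq n2.
pose i2 : 'I_n := Ordinal n2.
apply: Or33; apply: star_hom_dim_iso (cbase_doubling eU altA hH (i := i2) _).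
- by do 2!apply: cd_definite_norm.
- by rewrite dimvf (_ : n = 3%N) //; apply/eqP; rewrite eqn_leq n3.
move=> [z w] /=; apply: twistsD; first exact: (twC i0 i2).
rewrite smulDl !smulZl smul1l; apply: twistsD; apply: twistsZ.
  exact: (tw1 i1 i2).
exact: (twM i0 i1 i2).
Qed.

(** * Systems of Cartan pairs of size one *)

(** The partner of a singleton side [L] has to range over all the sets different
    from [L], hence over all the symmetric differences of [L] with a nonempty
    set [K]. *)
Lemma cartan_number1_unit_basis
  (R : realType) (n : nat) (A : cartanStarAlgebra R n) :
  (0 < n)%N -> cartan_number A = 1%N -> unit_basis A.
Proof.
move=> n0 A1.
have [C CP sC] : exists2 C, scp A C & scp_size C = 1%N.
  have [/existsP exC|/existsPn noC] := boolP [exists C, scp A C].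
    by have [[C CP ACE] _] := cartan_number_min exC; exists C; rewrite // -ACE.
  (* Without any system, the number is 2 ^ n, which is not 1. *)
  move: A1; rewrite /cartan_number big_pred0; last first.
    by move=> C; exact/negbTE.
  by move/eqP; rewrite -[X in _ == X](expn0 2) eqn_exp2l // gtn_eqF.
case/and3P: CP => /forall_inP pairC /eqP cover /eqP disj.
have inC K : K \in scp_left C :|: scp_right C by rewrite cover inE.
have unitD L M : (L, M) \in C -> cbase A (symdiff L M) \in imag_units A.
  by move=> /pairC; rewrite cartan_pairE.
move=> K K0; move: sC; rewrite /scp_size /minn; case: ifP => _;
  move=> /eqP/cards1P[L CL].
- have : symdiff L K \in scp_right C.
    have := inC (symdiff L K); rewrite inE CL inE => /orP[|//].
    by rewrite -symdiff_eq0 symdiffC symdiffKl (negPf K0).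
  case/imsetP=> -[L' M] LMC /= defM; have := unitD _ _ LMC; rewrite -defM.
  have : L' \in scp_left C by apply/imsetP; exists (L', M).
  by rewrite CL inE => /eqP ->; rewrite symdiffKl.
- have : symdiff L K \in scp_left C.
    have := inC (symdiff L K); rewrite inE CL [X in _ || X]inE => /orP[//|].
    by rewrite -symdiff_eq0 symdiffC symdiffKl (negPf K0).
  case/imsetP=> -[L' M] LMC /= defL; have := unitD _ _ LMC; rewrite -defL.
  have : M \in scp_right C by apply/imsetP; exists (L', M).
  by rewrite CL inE => /eqP ->; rewrite symdiffC symdiffKl.
Qed.

Lemma unit_basis_cartan_number1
  (R : realType) (n : nat) (A : cartanStarAlgebra R n) :
  (0 < n)%N -> unit_basis A -> cartan_number A = 1%N.
Proof.
move=> n0 eU.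
pose C := [set (set0 : {set 'I_n}, K) | K in [set~ set0 : {set 'I_n}]].
have inC p : p \in C = (p.1 == set0) && (p.2 != set0).
  apply/imsetP/andP=> [[K + ->]|[/eqP p1 p2]]; first by rewrite !inE eqxx.
  by exists p.2; rewrite ?inE // -p1; case: p {p1 p2}.
have ne : setT != set0 :> {set 'I_n}.
  by apply/set0Pn; exists (Ordinal n0).
have leftC : scp_left C = [set set0].
  apply/setP=> K; rewrite inE; apply/imsetP/eqP=> [[p + ->]|->].
    by rewrite inC => /andP[/eqP].
  by exists (set0, setT); rewrite ?inC ?eqxx ?ne.
have rightC : scp_right C = [set~ set0].
  apply/setP=> K; rewrite !inE; apply/imsetP/idP=> [[p + ->]|K0].
    by rewrite inC => /andP[].
  by exists (set0, K); rewrite ?inC ?eqxx ?K0.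
have CP : scp A C.
  apply/and3P; split.
  - apply/forall_inP=> p; rewrite inC => /andP[/eqP p1 p2].
    by rewrite cartan_pairE p1 symdiff0l eU.
  - by rewrite leftC rightC setUCr.
  - by rewrite leftC rightC setICr.
(* A system covers the power set, so neither of its sides is empty. *)
have [[D DP defA] minA] := cartan_number_min (ex_intro _ C CP).
apply/eqP; rewrite eqn_leq; apply/andP; split.
  by rewrite (leq_trans (minA _ CP)) // /scp_size leftC cards1 geq_minl.
rewrite defA /scp_size leq_min !card_gt0.
case/and3P: DP => _ /eqP cover _.
have : set0 \in scp_left D :|: scp_right D by rewrite cover inE.
by case/setUP=> /imsetP[p pD _]; apply/andP; split; apply/set0Pn;
   [exists p.1|exists p.2|exists p.1|exists p.2]; apply/imsetP; exists p.
Qed.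

(** * From the standard algebras to imaginary units *)

(** With [u = e_K], [u^c = t - u] and [u^2 = s], where [s] is 1 or -1, the norm
    equation reads [t u = m + s]; as [u] is not real, [t = 0] and then
    [s = - m], which is not positive. *)
Lemma definite_unit_basis
  (R : realType) (n : nat) (A : cartanStarAlgebra R n) :
  scalar_trace A -> definite_norm A -> unit_basis A.
Proof.
move=> trA dA K K0; set u := cbase A K.
have [t tu] := trA u; have [m [m0 mu _]] := dA u.
have uu : u ** u = csign A K K *: sone A.
  by rewrite /u cbaseM symdiffxx cbase0.
have uc : u^c = t *: sone A - u by rewrite -tu addrC addKr.
have tmu : t *: u = (m + csign A K K) *: sone A.
  rewrite scalerDl -mu -uu uc smulDr smulNr smulZr smul1r.
  by rewrite subrK.
have t0 : t = 0.
  apply: contraTeq (cbase_not_scalar A (t^-1 * (m + csign A K K)) K0) => tn0.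
  by rewrite negbK -scalerA -tmu scalerA mulVf // scale1r.
apply/imag_unitsP; rewrite uc t0 scale0r sub0r uu; split=> //.
case: (csign_pm1 A K K) => s1; first by rewrite s1 scaleN1r.
move/esym/eqP: tmu; rewrite t0 scale0r scaler_eq0 (negPf (sone_neq0 A)) orbF s1.
by rewrite gt_eqF // ltr_wpDl.
Qed.

Theorem theorem6p11 (R : realType) (n : nat) (A : cartanStarAlgebra R n) :
  (0 < n)%N ->
  alternative A ->
  (exists J : A, J \in imag_units A) ->
  cartan_number A = 1%N <-> standard_division_algebra A.
Proof.
move=> n0 altA _; split=> [A1|stdA].
  exact: (unit_basis_standard n0 altA (cartan_number1_unit_basis n0 A1)).
apply: (unit_basis_cartan_number1 n0); apply: definite_unit_basis.
- apply: (standard_transfer _ _ _ stdA).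
  + exact: scalar_trace_iso.
  + exact: complex_scalar_trace.
  + exact: cd_scalar_trace.
- apply: (standard_transfer _ _ _ stdA).
  + exact: definite_norm_iso.
  + exact: complex_definite_norm.
  + exact: cd_definite_norm.
Qed.
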